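(* Let $D\subset\mathbb{R}^2$ be a nonempty connected open set, and let $$S:\ \boldsymbol{x}(s,t)=\bigl(s,\ t,\ \widetilde f(s)+\widetilde h(t)\bigr),\qquad (s,t)\in D,$$ be a translation surface in Euclidean 3-space $E^3$, where $\widetilde f$ and $\widetilde h$ are sufficiently differentiable (of class $C^3$) real functions on the projections of $D$ to the $s$-axis and the $t$-axis respectively. Assume that the Gaussian curvature of $S$ never vanishes, i.e. $\widetilde f''(s)\neq 0$ and $\widetilde h''(t)\neq 0$ for all $(s,t)\in D$. Let $\Delta^{III}$ be the second Beltrami (Laplace) operator of the third fundamental form $III$ of $S$. Then there exists a real $3\times 3$ matrix $\Lambda$ such that $$\Delta^{III}\boldsymbol{x}=\Lambda\boldsymbol{x}\quad\text{on } D$$ (with $\Delta^{III}$ applied to each coordinate function of $\boldsymbol{x}$) if and only if $S$ is (an open part of) Scherk's minimal surface, i.e. if and only if there are real constants $a_1\neq 0$, $a_2$, $b_2$, $c$ such that for all $(s,t)\in D$ one has $\cos(a_1s+a_2)\neq 0$, $\cos(-a_1t+b_2)\neq 0$ and $$\widetilde f(s)+\widetilde h(t)=c-\frac{1}{a_1}\ln\bigl|\cos(a_1s+a_2)\bigr|+\frac{1}{a_1}\ln\bigl|\cos(-a_1t+b_2)\bigr|.$$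
   Context: The third fundamental form of a surface with position vector $\boldsymbol{x}(s,t)$ and unit normal (Gauss map) $\boldsymbol{n}(s,t)$ is $III=\langle d\boldsymbol{n},d\boldsymbol{n}\rangle$; since the Gaussian curvature never vanishes, $III$ is a Riemannian metric on the parameter domain $D$. The operator $\Delta^{III}$ is the Laplace–Beltrami operator of the metric $III$ with the sign convention $\Delta=-\operatorname{div}\operatorname{grad}$: writing $III=\sum e_{ij}\,du^i\,du^j$ with $(u^1,u^2)=(s,t)$, $e=\det(e_{ij})$ and $(e^{ij})=(e_{ij})^{-1}$, $$\Delta^{III}\varphi=-\frac{1}{\sqrt{e}}\sum_{i,j}\frac{\partial}{\partial u^i}\Bigl(\sqrt{e}\,e^{ij}\frac{\partial\varphi}{\partial u^j}\Bigr).$$ For the translation surface, with $f=\widetilde f'$ and $h=\widetilde h'$, one has $\boldsymbol{n}=(-f,-h,1)/\sqrt{1+f^2+h^2}$ (up to sign), and the Gaussian curvature is $K=f'(s)h'(t)/(1+f^2+h^2)^2$. *)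

(* Defs.v *)
From Stdlib Require Import Reals.
From Coquelicot Require Import Coquelicot.
Open Scope R_scope.

Definition connected {T : UniformSpace} (D : T -> Prop) : Prop :=
  forall U V : T -> Prop, open U -> open V ->
    (forall p, D p -> U p \/ V p) ->
    (exists p, D p /\ U p) -> (exists p, D p /\ V p) ->
    exists p, D p /\ U p /\ V p.

(** [Derive_n] looks at [f] in a neighbourhood of [x] in [R], so this is the
    usual notion of class [C^k] for an open set [I]; it does not depend on the
    values of [f] outside [I]. *)
Definition class_C (k : nat) (f : R -> R) (I : R -> Prop) : Prop :=
  forall x, I x ->
    (forall j, (j <= k)%nat -> ex_derive_n f j x) /\ continuous (Derive_n f k) x.

(** Column vectors of [R^3] are [3 x 1] matrices; indices start at [0]. *)
Notation vec3 := (@matrix R 3 1).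
Notation ent A i j := (coeff_mat (T := R) 0 A i j).

Definition mkvec3 (a b c : R) : vec3 := [[a], [b], [c]].
Definition coord (v : vec3) (k : nat) : R := ent v k 0.

Definition dot (v w : vec3) : R := sum_n (fun k => coord v k * coord w k) 2.

Definition cross (v w : vec3) : vec3 :=
  mkvec3 (coord v 1 * coord w 2 - coord v 2 * coord w 1)
         (coord v 2 * coord w 0 - coord v 0 * coord w 2)
         (coord v 0 * coord w 1 - coord v 1 * coord w 0).

Definition normalize (v : vec3) : vec3 :=
  mk_matrix 3 1 (fun k _ => coord v k / sqrt (dot v v)).

(** The parameters are [(u^0, u^1) = (s, t)]; only [i = 0, 1] are used. *)
Definition partial (i : nat) (phi : R -> R -> R) (s t : R) : R :=
  match i with
  | O => Derive (fun s' => phi s' t) s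
  | _ => Derive (fun t' => phi s t') t
  end.

Definition vpartial (i : nat) (x : R -> R -> vec3) (s t : R) : vec3 :=
  mk_matrix 3 1 (fun k _ => partial i (fun s' t' => coord (x s' t') k) s t).

Definition gauss_map (x : R -> R -> vec3) (s t : R) : vec3 :=
  normalize (cross (vpartial 0 x s t) (vpartial 1 x s t)).

Definition form_I (x : R -> R -> vec3) (s t : R) : @matrix R 2 2 :=
  mk_matrix 2 2 (fun i j => dot (vpartial i x s t) (vpartial j x s t)).

Definition form_II (x : R -> R -> vec3) (s t : R) : @matrix R 2 2 :=
  mk_matrix 2 2 (fun i j => dot (vpartial i (vpartial j x) s t) (gauss_map x s t)).

Definition form_III (x : R -> R -> vec3) (s t : R) : @matrix R 2 2 :=
  mk_matrix 2 2 (fun i j =>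
    dot (vpartial i (gauss_map x) s t) (vpartial j (gauss_map x) s t)).

Definition det2 (g : @matrix R 2 2) : R :=
  ent g 0 0 * ent g 1 1 - ent g 0 1 * ent g 1 0.

Definition inv2 (g : @matrix R 2 2) : @matrix R 2 2 :=
  [[  ent g 1 1 / det2 g, - ent g 0 1 / det2 g],
   [- ent g 1 0 / det2 g,   ent g 0 0 / det2 g]].

Definition gauss_curvature (x : R -> R -> vec3) (s t : R) : R :=
  det2 (form_II x s t) / det2 (form_I x s t).

(** Sign convention [Delta = - div grad]. *)
Definition laplace_beltrami (g : R -> R -> @matrix R 2 2)
    (phi : R -> R -> R) (s t : R) : R :=
  - (1 / sqrt (det2 (g s t))) *
    sum_n (fun i => sum_n (fun j =>
      partial i (fun s' t' =>
        sqrt (det2 (g s' t')) * ent (inv2 (g s' t')) i j * partial j phi s' t')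
        s t) 1) 1.

Definition Delta_III (x : R -> R -> vec3) (phi : R -> R -> R) : R -> R -> R :=
  laplace_beltrami (form_III x) phi.

Definition translation_surface (ft ht : R -> R) (s t : R) : vec3 :=
  mkvec3 s t (ft s + ht t).

(* Main.v *)
(** With [f = ft'], [h = ht'] and [W = 1 + f^2 + h^2] one finds
    [Delta s = W A(s)], [Delta t = W B(t)] and
    [Delta z = W (f A + h B - (1 + f^2) / f' - (1 + h^2) / h')], where
    [A = - ((1 + f^2) / f')' / f'] and likewise for [B].  If [W A] is linear in
    the position, subtracting the equations at two values of [t] shows that [A]
    is locally constant, and its vanishing follows from a cubic equation
    satisfied by the nonconstant [f].  Hence [f' / (1 + f^2)] and
    [h' / (1 + h^2)] are locally constant, and a third cubic equation makes
    their sum vanish.  This is [H = 0], and integrating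
    [f' = a1 (1 + f^2)], [h' = - a1 (1 + h^2)] over the connected set [D] gives
    Scherk's surface, for which conversely [Lambda = 0]. *)
Require Import Defs.
From Stdlib Require Import Reals Lra Lia.
From Coquelicot Require Import Coquelicot.
Open Scope R_scope.

(** * Vectors of [R^3] and their partial derivatives *)

Lemma coord_mk_matrix (F : nat -> nat -> R) (k : nat) :
  (k < 3)%nat -> coord (mk_matrix 3 1 F) k = F k 0%nat.
Proof. intros Hk; apply coeff_mat_bij; [exact Hk | auto]. Qed.

Lemma dot_mkvec3 (a b c a' b' c' : R) :
  dot (mkvec3 a b c) (mkvec3 a' b' c') = a * a' + b * b' + c * c'.
Proof. unfold dot; rewrite !sum_Sn, sum_O; reflexivity. Qed.

Lemma vpartial_mkvec3 (i : nat) (a b c : R -> R -> R) (s t : R) :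
  vpartial i (fun s' t' => mkvec3 (a s' t') (b s' t') (c s' t')) s t
  = mkvec3 (partial i a s t) (partial i b s t) (partial i c s t).
Proof. reflexivity. Qed.

Lemma vpartial_ext (i : nat) (x y : R -> R -> vec3) (s t : R) :
  (forall s' t', x s' t' = y s' t') -> vpartial i x s t = vpartial i y s t.
Proof.
  intros H; apply mk_matrix_ext; intros k j _ _.
  destruct i; apply Derive_ext; intros; rewrite H; reflexivity.
Qed.

(** The difference quotients of both functions coincide, so the two [Lim] values agree even where
    they are default values. *)
Lemma Derive_plus_const (f : R -> R) (c x : R) :
  Derive (fun y => f y + c) x = Derive f x.
Proof. unfold Derive; f_equal; apply Lim_ext; intros; f_equal; ring. Qed.

(** * Normal vector and Gaussian curvature of a translation surface *)

Section TranslationSurface.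

Variables ft ht : R -> R.
Local Notation x := (translation_surface ft ht).
Local Notation f := (Derive ft).
Local Notation h := (Derive ht).
Local Notation W s t := (1 + f s * f s + h t * h t).

Lemma W_pos (s t : R) : 0 < W s t.
Proof. nra. Qed.

Lemma vpartial_translation_surface_0 (s t : R) :
  vpartial 0 x s t = mkvec3 1 0 (f s).
Proof.
  unfold translation_surface; rewrite vpartial_mkvec3; unfold partial.
  rewrite Derive_id, Derive_const, Derive_plus_const; reflexivity.
Qed.

Lemma vpartial_translation_surface_1 (s t : R) :
  vpartial 1 x s t = mkvec3 0 1 (h t).
Proof.
  unfold translation_surface; rewrite vpartial_mkvec3; unfold partial.
  rewrite Derive_id, Derive_const.
  rewrite (Derive_ext _ (fun t' => ht t' + ft s)) by (intros; ring).
  rewrite Derive_plus_const; reflexivity.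
Qed.

Lemma gauss_map_translation_surface (s t : R) :
  gauss_map x s t
  = mkvec3 (- f s / sqrt (W s t)) (- h t / sqrt (W s t)) (1 / sqrt (W s t)).
Proof.
  unfold gauss_map.
  rewrite vpartial_translation_surface_0, vpartial_translation_surface_1.
  replace (cross _ _) with (mkvec3 (- f s) (- h t) 1).
  2: { unfold cross; 
       apply (f_equal3 mkvec3); unfold coord; cbn; ring. }
  unfold normalize; rewrite dot_mkvec3.
  replace (- f s * - f s + - h t * - h t + 1 * 1) with (W s t) by ring.
  reflexivity.
Qed.

(** The second form is diagonal with entries [f' / sqrt W] and [h' / sqrt W]. A zero factor in its
    determinant makes the quotient [K] vanish whatever the first form is. *)
Lemma gauss_curvature_neq0 (s t : R) :
  gauss_curvature x s t <> 0 -> Derive f s <> 0 /\ Derive h t <> 0.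
Proof.
  intros HK.
  enough (E : det2 (form_II x s t) = Derive f s * Derive h t / W s t).
  { unfold gauss_curvature in HK; rewrite E in HK.
    split; intros H0; apply HK; rewrite H0; unfold Rdiv; ring. }
  unfold det2, form_II; rewrite !coeff_mat_bij by auto.
  rewrite gauss_map_translation_surface.
  rewrite (vpartial_ext _ (vpartial 0 x) _ _ _ vpartial_translation_surface_0).
  rewrite (vpartial_ext _ (vpartial 1 x) _ _ _ vpartial_translation_surface_1).
  rewrite (vpartial_ext 1 (vpartial 0 x) _ _ _ vpartial_translation_surface_0).
  rewrite (vpartial_ext 0 (vpartial 1 x) _ _ _ vpartial_translation_surface_1).
  rewrite !vpartial_mkvec3, !dot_mkvec3; unfold partial.
  rewrite !Derive_const.
  change (fun y : R => Derive ft y) with (Derive ft).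
  change (fun y : R => Derive ht y) with (Derive ht).
  assert (HW := W_pos s t).
  replace (_ / W s t)
    with (Derive f s * Derive h t / (sqrt (W s t) * sqrt (W s t)))
    by (rewrite sqrt_sqrt; lra).
  assert (sqrt (W s t) <> 0) by (apply Rgt_not_eq, sqrt_lt_R0, HW).
  field; assumption.
Qed.

(** * Derivatives of the Gauss map and the third fundamental form *)

(** The components of the normal and the coefficients [sqrt e * e^ij] all have denominator [sqrt W];
    this rule differentiates both. *)
Lemma is_derive_div_sqrt (a b : R -> R) (z da db : R) :
  is_derive a z da -> is_derive b z db -> 0 < b z ->
  is_derive (fun y => a y / sqrt (b y)) z
    ((da * b z - a z * db / 2) / (b z * sqrt (b z))).
Proof.
  intros Ha Hb Hp.
  assert (Hs : 0 < sqrt (b z)) by (apply sqrt_lt_R0, Hp).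
  auto_derive.
  - repeat split; try (eexists; eassumption); lra.
  - replace (Derive (fun y => a y) z) with da
      by (symmetry; apply is_derive_unique, Ha).
    replace (Derive (fun y => b y) z) with db
      by (symmetry; apply is_derive_unique, Hb).
    assert (E : b z = sqrt (b z) * sqrt (b z)) by (rewrite sqrt_sqrt; lra).
    set (r := sqrt (b z)) in *; rewrite E; field; lra.
Qed.

Lemma is_derive_square_plus (u : R -> R) (a c z du : R) :
  is_derive u z du ->
  is_derive (fun y => a + u y * u y + c) z (2 * u z * du).
Proof.
  intros H; auto_derive; [repeat split; eexists; eassumption|].
  replace (Derive (fun y => u y) z) with du
    by (symmetry; apply is_derive_unique, H); ring.
Qed.

Lemma is_derive_W_l (s t df : R) : is_derive f s df ->
  is_derive (fun s' => W s' t) s (2 * f s * df).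
Proof. apply (is_derive_square_plus f 1 (h t * h t)). Qed.

Lemma is_derive_W_r (s t dh : R) : is_derive h t dh ->
  is_derive (fun t' => W s t') t (2 * h t * dh).
Proof.
  intros H; apply (is_derive_square_plus _ (1 + f s * f s) 0) in H.
  apply is_derive_ext with (2 := H); intros y; cbn; ring.
Qed.

Lemma vpartial_gauss_map_0 (s t : R) : ex_derive f s ->
  vpartial 0 (gauss_map x) s t =
  mkvec3 (- Derive f s * (1 + h t * h t) / (W s t * sqrt (W s t)))
         (Derive f s * f s * h t / (W s t * sqrt (W s t)))
         (- Derive f s * f s / (W s t * sqrt (W s t))).
Proof.
  intros Hf; apply Derive_correct in Hf.
  assert (HW := is_derive_W_l s t _ Hf).
  rewrite (vpartial_ext _ _ _ _ _ gauss_map_translation_surface), vpartial_mkvec3.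
  unfold partial; f_equal; apply is_derive_unique; (eapply is_derive_ext_loc;
    [apply filter_forall; intros; reflexivity|]).
  - evar_last. apply is_derive_div_sqrt; [| exact HW | apply W_pos].
    apply (is_derive_opp f), Hf.
    unfold opp; cbn; f_equal; field.
  - evar_last. apply is_derive_div_sqrt; [| exact HW | apply W_pos].
    apply (is_derive_const (- h t)).
    unfold zero; cbn; f_equal; field.
  - evar_last. apply is_derive_div_sqrt; [| exact HW | apply W_pos].
    apply (is_derive_const 1).
    unfold zero; cbn; f_equal; field.
Qed.

Lemma matrix_2_2_ext (a b c d a' b' c' d' : R) :
  a = a' -> b = b' -> c = c' -> d = d' ->
  [[a, b], [c, d]] = [[a', b'], [c', d']] :> (@matrix R 2 2).
Proof. intros -> -> -> ->; reflexivity. Qed.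

Lemma vpartial_gauss_map_1 (s t : R) : ex_derive h t ->
  vpartial 1 (gauss_map x) s t =
  mkvec3 (Derive h t * f s * h t / (W s t * sqrt (W s t)))
         (- Derive h t * (1 + f s * f s) / (W s t * sqrt (W s t)))
         (- Derive h t * h t / (W s t * sqrt (W s t))).
Proof.
  intros Hh; apply Derive_correct in Hh.
  assert (HW := is_derive_W_r s t _ Hh).
  rewrite (vpartial_ext _ _ _ _ _ gauss_map_translation_surface), vpartial_mkvec3.
  unfold partial; f_equal; apply is_derive_unique; (eapply is_derive_ext_loc;
    [apply filter_forall; intros; reflexivity|]).
  - evar_last. apply is_derive_div_sqrt; [| exact HW | apply W_pos].
    apply (is_derive_const (- f s)).
    unfold zero; cbn; f_equal; field.
  - evar_last. apply is_derive_div_sqrt; [| exact HW | apply W_pos].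
    apply (is_derive_opp h), Hh.
    unfold opp; cbn; f_equal; field.
  - evar_last. apply is_derive_div_sqrt; [| exact HW | apply W_pos].
    apply (is_derive_const 1).
    unfold zero; cbn; f_equal; field.
Qed.

(** The scalar products have denominator [W^3], and each numerator contains a factor [W], for
    example [(1 + h^2)^2 + f^2 h^2 + f^2 = (1 + h^2) W]. *)
Lemma form_III_translation_surface (s t : R) : ex_derive f s -> ex_derive h t ->
  form_III x s t =
  [[ (Derive f s)^2 * (1 + h t * h t) / (W s t)^2,
     - (Derive f s * Derive h t * f s * h t) / (W s t)^2 ],
   [ - (Derive f s * Derive h t * f s * h t) / (W s t)^2,
     (Derive h t)^2 * (1 + f s * f s) / (W s t)^2 ]].
Proof.
  intros Hf Hh.
  assert (HW := W_pos s t).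
  assert (Hr : 0 < sqrt (W s t)) by (apply sqrt_lt_R0, HW).
  assert (E : sqrt (W s t) * sqrt (W s t) = W s t) by (apply sqrt_sqrt; lra).
  unfold form_III, mk_matrix; cbn [mk_Tn].
  rewrite vpartial_gauss_map_0, vpartial_gauss_map_1, !dot_mkvec3 by assumption.
  set (r := sqrt (W s t)) in *.
  assert (Q : forall a b, a / (W s t * r) * (b / (W s t * r)) = a * b / (W s t)^3).
  { intros a b; transitivity (a * b / (W s t * W s t * (r * r))).
    - field; lra.
    - rewrite E; field; lra. }
  apply matrix_2_2_ext; rewrite !Q; field; lra.
Qed.

(** Since [(1 + f^2)(1 + h^2) - f^2 h^2 = W], the determinant is [(f' h')^2 / W^3]. The number [eps]
    is the sign of [f' h']; it replaces the absolute value in the square root by a constant factor,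
    which is easy to differentiate. *)
Lemma metric_coefficients (s t eps : R) :
  ex_derive f s -> ex_derive h t -> eps * eps = 1 ->
  0 < eps * (Derive f s * Derive h t) ->
  let g := form_III x s t in
  sqrt (det2 g) = eps * (Derive f s * Derive h t) / (W s t * sqrt (W s t)) /\
  sqrt (det2 g) * ent (inv2 g) 0 0
    = eps * Derive h t * ((1 + f s * f s) / Derive f s) / sqrt (W s t) /\
  sqrt (det2 g) * ent (inv2 g) 0 1 = eps * (f s * h t) / sqrt (W s t) /\
  sqrt (det2 g) * ent (inv2 g) 1 0 = eps * (f s * h t) / sqrt (W s t) /\
  sqrt (det2 g) * ent (inv2 g) 1 1
    = eps * Derive f s * ((1 + h t * h t) / Derive h t) / sqrt (W s t).
Proof.
  intros Hf Hh He Hp g; unfold g; rewrite form_III_translation_surface by assumption.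
  assert (HW := W_pos s t).
  assert (Hr : 0 < sqrt (W s t)) by (apply sqrt_lt_R0, HW).
  assert (E : sqrt (W s t) * sqrt (W s t) = W s t) by (apply sqrt_sqrt; lra).
  assert (Hf1 : Derive f s <> 0) by (intros H; rewrite H in Hp; lra).
  assert (Hh1 : Derive h t <> 0) by (intros H; rewrite H in Hp; lra).
  match goal with |- sqrt (det2 ?M) = _ /\ _ => set (G := M) end.
  assert (Hd : det2 G = (Derive f s * Derive h t)^2 / (W s t)^3).
  { unfold det2, G, coeff_mat; cbn -[Rmult Rplus Rdiv Ropp pow Derive].
    field; lra. }
  set (r := sqrt (W s t)) in *.
  assert (Hs : sqrt (det2 G) = eps * (Derive f s * Derive h t) / (W s t * r)).
  { apply sqrt_lem_1.
    - rewrite Hd; apply Rdiv_le_0_compat; [apply pow2_ge_0 | apply pow_lt, HW].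
    - apply Rlt_le, Rdiv_lt_0_compat; [exact Hp | nra].
    - rewrite Hd.
      transitivity ((eps * eps) * (Derive f s * Derive h t)^2 / (W s t * W s t * (r * r))).
      + field; lra.
      + rewrite E, He; field; lra. }
  split; [exact Hs|].
  assert (Q : forall a b, b = a * (W s t * (W s t * W s t)) / (Derive f s * Derive h t)^2 ->
    sqrt (det2 G) * (a / det2 G) =
    eps * (Derive f s * Derive h t) * (b / (W s t)) / r).
  { intros a b ->; rewrite Hs, Hd; field; lra. }
  unfold inv2; repeat split; unfold coeff_mat at 1; cbn [fst snd coeff_Tn];
  (erewrite Q; [|reflexivity]); unfold G, coeff_mat;
  cbn -[Rmult Rplus Rdiv Ropp pow Derive sqrt]; field; lra.
Qed.

(** * The Laplacian of the third form in coordinates *)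

Lemma is_derive_mult_div_sqrt (u b : R -> R) (k z du db : R) :
  is_derive u z du -> is_derive b z db -> 0 < b z ->
  is_derive (fun y => u y / sqrt (b y) * k) z
    ((du * b z - u z * db / 2) / (b z * sqrt (b z)) * k).
Proof.
  intros Hu Hb Hp.
  assert (H := is_derive_div_sqrt u b z du db Hu Hb Hp).
  exact (is_derive_scal_l _ z _ k H).
Qed.

(** Used for both diagonal terms of the divergence: [v] is the derivative of the slope [u], [b] is
    [W], [a] is the partial derivative of the function, and [c] collects the factors frozen in the
    direction of differentiation. *)
Lemma is_derive_diagonal_coefficient (u v a b : R -> R) (c z du dv da db : R) :
  is_derive u z du -> is_derive v z dv -> is_derive a z da ->
  is_derive b z db -> v z <> 0 -> 0 < b z ->
  is_derive (fun y => c * ((1 + u y * u y) / v y) / sqrt (b y) * a y) z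
    ((c * (2 * u z * du / v z - (1 + u z * u z) * dv / (v z)^2)
       / sqrt (b z)
     - c * ((1 + u z * u z) / v z) * db / (2 * (b z * sqrt (b z)))) * a z
     + c * ((1 + u z * u z) / v z) / sqrt (b z) * da).
Proof.
  intros Hu Hv Ha Hb Hv0 Hb0.
  assert (Hr : 0 < sqrt (b z)) by (apply sqrt_lt_R0, Hb0).
  assert (Hn : is_derive (fun y => c * ((1 + u y * u y) / v y)) z
    (c * (2 * u z * du / v z - (1 + u z * u z) * dv / (v z)^2))).
  { auto_derive.
    - repeat split; try (eexists; eassumption); assumption.
    - replace (Derive (fun y => u y) z) with du
        by (symmetry; apply is_derive_unique, Hu).
      replace (Derive (fun y => v y) z) with dv
        by (symmetry; apply is_derive_unique, Hv).
      field; assumption. }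
  evar_last.
  - apply (is_derive_mult (fun y => c * ((1 + u y * u y) / v y) / sqrt (b y)) a);
      [apply is_derive_div_sqrt; eassumption | exact Ha | intros; apply Rmult_comm].
  - unfold plus, mult; cbn -[pow]; field; repeat split; lra.
Qed.

Lemma locally_sign (v : R -> R) (z k : R) :
  ex_derive v z -> 0 < k * v z -> locally z (fun y => 0 < k * v y).
Proof.
  intros Hv Hp.
  assert (Hc : continuous (fun y => k * v y) z).
  { apply (continuous_scal_r k v), ex_derive_continuous, Hv. }
  apply (Hc (fun y => 0 < y)), open_gt, Hp.
Qed.

(** All three coordinate functions have partial derivatives depending on one variable each, so one
    computation serves them all and no mixed second derivative of [phi] occurs. *)
Lemma Delta_III_translation_surface (phi : R -> R -> R) (a b : R -> R) (s t da db : R) :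
  locally s (fun s' => ex_derive f s') -> locally t (fun t' => ex_derive h t') ->
  ex_derive (Derive f) s -> ex_derive (Derive h) t ->
  Derive f s <> 0 -> Derive h t <> 0 ->
  (forall s' t', partial 0 phi s' t' = a s') ->
  (forall s' t', partial 1 phi s' t' = b t') ->
  is_derive a s da -> is_derive b t db ->
  Delta_III x phi s t =
  W s t *
    (((1 + f s * f s) * Derive (Derive f) s / (Derive f s)^3 - 2 * f s / Derive f s) * a s
     + ((1 + h t * h t) * Derive (Derive h) t / (Derive h t)^3 - 2 * h t / Derive h t) * b t
     - (1 + f s * f s) / (Derive f s)^2 * da - (1 + h t * h t) / (Derive h t)^2 * db).
Proof.
  intros Lf Lh Hf2 Hh2 Hf1 Hh1 Pa Pb Ha Hb.
  assert (Hf : ex_derive f s) by apply (locally_singleton _ _ Lf).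
  assert (Hh : ex_derive h t) by apply (locally_singleton _ _ Lh).
  assert (exists eps, eps * eps = 1 /\ 0 < eps * (Derive f s * Derive h t))
    as [eps [He Hp]].
  { assert (Derive f s * Derive h t <> 0) as [Hn|Hn]%Rdichotomy
      by (apply Rmult_integral_contrapositive; auto).
    - exists (-1); split; lra.
    - exists 1; split; lra. }
  (* The sign of [f' h'] is fixed near the point, so the formulas with constant [eps] hold on a
     neighbourhood and may be differentiated. *)
  assert (Cs : locally s (fun s' => ex_derive f s' /\
    0 < eps * (Derive f s' * Derive h t))).
  { apply filter_and; [exact Lf|].
    eapply filter_imp; [|apply (locally_sign (Derive f) s (eps * Derive h t) Hf2); nra].
    cbn; intros y Hy; nra. }
  assert (Ct : locally t (fun t' => ex_derive h t' /\
    0 < eps * (Derive f s * Derive h t'))).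
  { apply filter_and; [exact Lh|].
    eapply filter_imp; [|apply (locally_sign (Derive h) t (eps * Derive f s) Hh2); nra].
    cbn; intros y Hy; nra. }
  destruct (metric_coefficients s t eps Hf Hh He Hp) as [Hs _].
  assert (HW := W_pos s t).
  assert (Hr : 0 < sqrt (W s t)) by (apply sqrt_lt_R0, HW).
  assert (E : sqrt (W s t) * sqrt (W s t) = W s t) by (apply sqrt_sqrt; lra).
  assert (DWs := is_derive_W_l s t _ (Derive_correct _ _ Hf)).
  assert (DWt := is_derive_W_r s t _ (Derive_correct _ _ Hh)).
  unfold Delta_III, laplace_beltrami.
  rewrite !(sum_Sn _ 0), !sum_O, !(sum_Sn _ 0), !sum_O.
  (* In these four assertions the value is left open and is filled in by the differentiation rule
     applied to the explicit coefficient. *)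
  eassert (E00 : Derive (fun s' => sqrt (det2 (form_III x s' t)) *
     ent (inv2 (form_III x s' t)) 0 0 * partial 0 phi s' t) s = _).
  { apply is_derive_unique; eapply is_derive_ext_loc.
    - eapply filter_imp; [|exact Cs]; intros s' [Ks Kp].
      destruct (metric_coefficients s' t eps Ks Hh He Kp) as (_ & -> & _).
      symmetry; rewrite (Pa s' t); reflexivity.
    - apply (is_derive_diagonal_coefficient f (Derive f) a (fun s' => W s' t));
        try eassumption; apply Derive_correct; assumption. }
  eassert (E01 : Derive (fun s' => sqrt (det2 (form_III x s' t)) *
     ent (inv2 (form_III x s' t)) 0 1 * partial 1 phi s' t) s = _).
  { apply is_derive_unique; eapply is_derive_ext_loc.
    - eapply filter_imp; [|exact Cs]; intros s' [Ks Kp].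
      destruct (metric_coefficients s' t eps Ks Hh He Kp) as (_ & _ & -> & _).
      symmetry; rewrite (Pb s' t); reflexivity.
    - apply (is_derive_mult_div_sqrt (fun s' => eps * (f s' * h t)) (fun s' => W s' t));
        [|eassumption|assumption].
      apply (is_derive_scal (fun s' => f s' * h t)).
      exact (is_derive_scal_l f s _ (h t) (Derive_correct _ _ Hf)). }
  eassert (E10 : Derive (fun t' => sqrt (det2 (form_III x s t')) *
     ent (inv2 (form_III x s t')) 1 0 * partial 0 phi s t') t = _).
  { apply is_derive_unique; eapply is_derive_ext_loc.
    - eapply filter_imp; [|exact Ct]; intros t' [Kt Kp].
      destruct (metric_coefficients s t' eps Hf Kt He Kp) as (_ & _ & _ & -> & _).
      symmetry; rewrite (Pa s t'); reflexivity.
    - apply (is_derive_mult_div_sqrt (fun t' => eps * (f s * h t')) (fun t' => W s t'));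
        [|eassumption|assumption].
      apply (is_derive_scal (fun t' => f s * h t')).
      apply (is_derive_scal h), Derive_correct, Hh. }
  eassert (E11 : Derive (fun t' => sqrt (det2 (form_III x s t')) *
     ent (inv2 (form_III x s t')) 1 1 * partial 1 phi s t') t = _).
  { apply is_derive_unique; eapply is_derive_ext_loc.
    - eapply filter_imp; [|exact Ct]; intros t' [Kt Kp].
      destruct (metric_coefficients s t' eps Hf Kt He Kp) as (_ & _ & _ & _ & ->).
      symmetry; rewrite (Pb s t'); reflexivity.
    - apply (is_derive_diagonal_coefficient h (Derive h) b (fun t' => W s t'));
        try eassumption; apply Derive_correct; assumption. }
  match goal with |- _ * plus (plus ?p ?q) (plus ?p' ?q') = _ =>
    change p with (Derive (fun s' => sqrt (det2 (form_III x s' t)) *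
      ent (inv2 (form_III x s' t)) 0 0 * partial 0 phi s' t) s);
    change q with (Derive (fun s' => sqrt (det2 (form_III x s' t)) *
      ent (inv2 (form_III x s' t)) 0 1 * partial 1 phi s' t) s);
    change p' with (Derive (fun t' => sqrt (det2 (form_III x s t')) *
      ent (inv2 (form_III x s t')) 1 0 * partial 0 phi s t') t);
    change q' with (Derive (fun t' => sqrt (det2 (form_III x s t')) *
      ent (inv2 (form_III x s t')) 1 1 * partial 1 phi s t') t)
  end.
  rewrite E00, E01, E10, E11, Hs; clear E00 E01 E10 E11.
  unfold scal; cbn -[pow sqrt]; unfold mult; cbn -[pow sqrt].
  (* What remains is a rational identity in which [r] and [eps] cancel, so [r] may be any positive
     number. *)
  clear E; set (r := sqrt (W s t)) in *; clearbody r.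
  field; repeat split; try lra; intros H; rewrite H in He; lra.
Qed.


(** The preceding formula with [(a, b)] equal to [(1, 0)], [(0, 1)] and [(f, h)]. *)
Lemma Delta_III_position (s t : R) :
  locally s (fun s' => ex_derive f s') -> locally t (fun t' => ex_derive h t') ->
  ex_derive (Derive f) s -> ex_derive (Derive h) t ->
  Derive f s <> 0 -> Derive h t <> 0 ->
  let A := (1 + f s * f s) * Derive (Derive f) s / (Derive f s)^3 - 2 * f s / Derive f s in
  let B := (1 + h t * h t) * Derive (Derive h) t / (Derive h t)^3 - 2 * h t / Derive h t in
  mk_matrix 3 1 (fun k _ => Delta_III x (fun s' t' => coord (x s' t') k) s t) =
  mkvec3 (W s t * A) (W s t * B)
    (W s t * (A * f s + B * h t
              - (1 + f s * f s) / Derive f s - (1 + h t * h t) / Derive h t)).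
Proof.
  intros Lf Lh Hf2 Hh2 Hf1 Hh1 A B.
  assert (Hf : is_derive f s (Derive f s))
    by apply Derive_correct, (locally_singleton _ _ Lf).
  assert (Hh : is_derive h t (Derive h t))
    by apply Derive_correct, (locally_singleton _ _ Lh).
  unfold mk_matrix; cbn [mk_Tn]; apply (f_equal3 mkvec3).
  - rewrite (Delta_III_translation_surface _ (fun _ => 1) (fun _ => 0) s t 0 0);
      try assumption; try apply @is_derive_const.
    + fold A B; ring.
    + intros s' t'; apply Derive_id.
    + intros s' t'; exact (Derive_const s' t').
  - rewrite (Delta_III_translation_surface _ (fun _ => 0) (fun _ => 1) s t 0 0);
      try assumption; try apply @is_derive_const.
    + fold A B; ring.
    + intros s' t'; exact (Derive_const t' s').
    + intros s' t'; apply Derive_id.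
  - rewrite (Delta_III_translation_surface _ f h s t (Derive f s) (Derive h t));
      try assumption.
    + fold A B; field; split; assumption.
    + intros s' t'; exact (Derive_plus_const ft (ht t') s').
    + intros s' t'; rewrite <- (Derive_plus_const ht (ft s') t').
      apply Derive_ext; intros; apply Rplus_comm.
Qed.

End TranslationSurface.

(** * Functions with nonvanishing derivative and cubic equations *)

Lemma is_derive_0_const (u : R -> R) (z r : R) :
  (forall y, Rabs (y - z) < r -> is_derive u y 0) ->
  forall y, Rabs (y - z) < r -> u y = u z.
Proof.
  intros H y Hy; apply Rabs_def2 in Hy.
  destruct (Rtotal_order y z) as [L|[->|L]]; [| reflexivity | symmetry];
    apply (eq_is_derive u); trivial;
    intros w Hw; apply H, Rabs_def1; lra.
Qed.

(** By the mean value theorem, equal values at [a] and [b] would force a zero of [u1] between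
    them. *)
Lemma derive_neq0_inj (u u1 : R -> R) (z r : R) :
  (forall y, Rabs (y - z) < r -> is_derive u y (u1 y)) ->
  (forall y, Rabs (y - z) < r -> u1 y <> 0) ->
  forall a b, Rabs (a - z) < r -> Rabs (b - z) < r -> a <> b -> u a <> u b.
Proof.
  intros Hu Hu1 a b Ha%Rabs_def2 Hb%Rabs_def2 Hab E.
  assert (K : forall y, Rmin a b <= y <= Rmax a b -> Rabs (y - z) < r).
  { intros y Hy; unfold Rmin, Rmax in Hy; destruct (Rle_dec a b);
      apply Rabs_def1; lra. }
  destruct (MVT_gen u a b u1) as [c [Hc Hm]].
  - intros y Hy; apply Hu, K; lra.
  - intros y Hy; apply derivable_continuous_pt, ex_derive_Reals_0.
    exists (u1 y); apply Hu, K, Hy.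
  - rewrite E, Rminus_diag in Hm; symmetry in Hm.
    apply Rmult_integral in Hm as [Hm|Hm]; [exact (Hu1 c (K c Hc) Hm) | lra].
Qed.

(** Third divided difference at four distinct points. *)
Lemma cubic_4_roots (c3 c2 c1 c0 y0 y1 y2 y3 : R) :
  (forall y, y = y0 \/ y = y1 \/ y = y2 \/ y = y3 ->
     c3 * y ^ 3 + c2 * y ^ 2 + c1 * y + c0 = 0) ->
  y0 <> y1 -> y0 <> y2 -> y0 <> y3 -> y1 <> y2 -> y1 <> y3 -> y2 <> y3 ->
  c3 = 0.
Proof.
  intros H N01 N02 N03 N12 N13 N23.
  pose (P y := c3 * y ^ 3 + c2 * y ^ 2 + c1 * y + c0).
  assert (E : c3 * ((y1 - y0) * (y2 - y0) * (y3 - y0) * (y2 - y1) * (y3 - y1) * (y3 - y2))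
    = - P y0 * ((y2 - y1) * (y3 - y1) * (y3 - y2))
      + P y1 * ((y2 - y0) * (y3 - y0) * (y3 - y2))
      - P y2 * ((y1 - y0) * (y3 - y0) * (y3 - y1))
      + P y3 * ((y1 - y0) * (y2 - y0) * (y2 - y1))) by (unfold P; ring).
  unfold P in E; rewrite !H in E by tauto.
  apply Rmult_eq_reg_r with (2 := ltac:(repeat apply Rmult_integral_contrapositive_currified; lra) :
    (y1 - y0) * (y2 - y0) * (y3 - y0) * (y2 - y1) * (y3 - y1) * (y3 - y2) <> 0).
  lra.
Qed.

Lemma Rabs_minus_diag_lt (c r : R) : 0 < r -> Rabs (c - c) < r.
Proof. rewrite Rminus_diag, Rabs_R0; trivial. Qed.

Lemma equispaced_values_neq (u u1 : R -> R) (z r k l : R) :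
  0 < r ->
  (forall y, Rabs (y - z) < r -> is_derive u y (u1 y)) ->
  (forall y, Rabs (y - z) < r -> u1 y <> 0) ->
  0 <= k < 4 -> 0 <= l < 4 -> k <> l ->
  u (z + k * (r / 4)) <> u (z + l * (r / 4)).
Proof.
  intros Hr Hu Hu1 Hk Hl Hkl; apply (derive_neq0_inj u u1 z r); trivial;
    try (apply Rabs_def1; nra).
  intros E; apply Hkl; nra.
Qed.

(** As [u] is injective, sampling it at four equispaced points gives the polynomial four distinct
    roots. *)
Lemma cubic_on_interval (u u1 : R -> R) (z r c3 c2 c1 c0 : R) :
  0 < r ->
  (forall y, Rabs (y - z) < r -> is_derive u y (u1 y)) ->
  (forall y, Rabs (y - z) < r -> u1 y <> 0) ->
  (forall y, Rabs (y - z) < r ->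
     c3 * u y ^ 3 + c2 * u y ^ 2 + c1 * u y + c0 = 0) ->
  c3 = 0.
Proof.
  intros Hr Hu Hu1 H.
  assert (K : forall k, 0 <= k < 4 -> Rabs (z + k * (r / 4) - z) < r)
    by (intros k Hk; apply Rabs_def1; nra).
  assert (J := fun k l => equispaced_values_neq u u1 z r k l Hr Hu Hu1).
  apply (cubic_4_roots c3 c2 c1 c0 (u (z + 0 * (r / 4))) (u (z + 1 * (r / 4)))
    (u (z + 2 * (r / 4))) (u (z + 3 * (r / 4)))); try (apply J; lra).
  intros y [-> | [-> | [-> | ->]]]; apply H, K; lra.
Qed.

(** Equal squares at [y] and [z] mean [u y = u z] or [u y = - u z]. Injectivity excludes the first
    for [y <> z] and allows the second for at most one [y], so two trial points suffice. *)
Lemma exists_square_neq (u u1 : R -> R) (z r : R) :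
  0 < r ->
  (forall y, Rabs (y - z) < r -> is_derive u y (u1 y)) ->
  (forall y, Rabs (y - z) < r -> u1 y <> 0) ->
  exists y, Rabs (y - z) < r /\ u y * u y - u z * u z <> 0.
Proof.
  intros Hr Hu Hu1.
  assert (K : forall k, 0 <= k < 4 -> Rabs (z + k * (r / 4) - z) < r)
    by (intros k Hk; apply Rabs_def1; nra).
  assert (J := fun k l => equispaced_values_neq u u1 z r k l Hr Hu Hu1).
  assert (J1 := J 0 1 ltac:(lra) ltac:(lra) ltac:(lra)).
  assert (J2 := J 0 2 ltac:(lra) ltac:(lra) ltac:(lra)).
  assert (J3 := J 1 2 ltac:(lra) ltac:(lra) ltac:(lra)).
  replace (z + 0 * (r / 4)) with z in * by ring.
  destruct (Req_dec (u (z + 1 * (r / 4)) + u z) 0) as [E1|E1].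
  - exists (z + 2 * (r / 4)); split; [apply K; lra|].
    replace (_ - _) with ((u (z + 2 * (r / 4)) - u z) * (u (z + 2 * (r / 4)) + u z)) by ring.
    apply Rmult_integral_contrapositive_currified; lra.
  - exists (z + 1 * (r / 4)); split; [apply K; lra|].
    replace (_ - _) with ((u (z + 1 * (r / 4)) - u z) * (u (z + 1 * (r / 4)) + u z)) by ring.
    apply Rmult_integral_contrapositive_currified; lra.
Qed.

(** * Linear equations for the position restrict the slopes *)

(** Both sides are differentiated in [s] with [t] frozen: [c] stands for the squared slope in [t],
    [d] for the height in [t], and [l2] absorbs the term linear in [t]. *)
Lemma is_derive_affine_relation (U u u1 : R -> R) (z r c a l1 l2 l3 d : R) :
  (forall s, Rabs (s - z) < r -> is_derive U s (u s)) ->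
  (forall s, Rabs (s - z) < r -> is_derive u s (u1 s)) ->
  (forall s, Rabs (s - z) < r ->
     (1 + u s * u s + c) * a = l1 * s + l2 + l3 * (U s + d)) ->
  forall s, Rabs (s - z) < r -> 2 * u s * u1 s * a = l1 + l3 * u s.
Proof.
  intros HU Hu H s Hs.
  assert (D1 : is_derive (fun s => (1 + u s * u s + c) * a) s (2 * u s * u1 s * a)).
  { auto_derive; [repeat split; eexists; apply (Hu s Hs)|].
    replace (Derive (fun y => u y) s) with (u1 s)
      by (symmetry; apply is_derive_unique, Hu, Hs); ring. }
  assert (D2 : is_derive (fun s => l1 * s + l2 + l3 * (U s + d)) s (l1 + l3 * u s)).
  { auto_derive; [repeat split; eexists; apply (HU s Hs)|].
    replace (Derive (fun y => U y) s) with (u s)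
      by (symmetry; apply is_derive_unique, HU, Hs); ring. }
  rewrite <- (is_derive_unique _ _ _ D1), <- (is_derive_unique _ _ _ D2).
  apply Derive_ext_loc.
  assert (Hd : 0 < r - Rabs (s - z)) by lra.
  exists (mkposreal _ Hd); intros s' Hs'; apply H.
  change (Rabs (s' - s) < r - Rabs (s - z)) in Hs'.
  replace (s' - z) with ((s' - s) + (s - z)) by ring.
  eapply Rle_lt_trans; [apply Rabs_triang | lra].
Qed.

(** The coefficient is [- w' / u'] with [w = (1 + u^2) / u'].  Comparing two
    values of [t] shows that it is a constant [alpha]; then [w] is affine in
    [u], and the [s]-derivative [2 u u' alpha = l1 + l3 u] of the hypothesis
    becomes a cubic equation for [u] with leading coefficient [2 alpha]. *)
Lemma slope_coefficient_eq0 (U u u1 u2 V v v1 : R -> R) (s0 t0 r l1 l2 l3 : R) :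
  0 < r ->
  (forall s, Rabs (s - s0) < r -> is_derive U s (u s)) ->
  (forall s, Rabs (s - s0) < r -> is_derive u s (u1 s)) ->
  (forall s, Rabs (s - s0) < r -> is_derive u1 s (u2 s)) ->
  (forall s, Rabs (s - s0) < r -> u1 s <> 0) ->
  (forall t, Rabs (t - t0) < r -> is_derive v t (v1 t)) ->
  (forall t, Rabs (t - t0) < r -> v1 t <> 0) ->
  (forall s t, Rabs (s - s0) < r -> Rabs (t - t0) < r ->
     (1 + u s * u s + v t * v t)
       * ((1 + u s * u s) * u2 s / (u1 s)^3 - 2 * u s / u1 s)
     = l1 * s + l2 * t + l3 * (U s + V t)) ->
  (forall s, Rabs (s - s0) < r ->
     (1 + u s * u s) * u2 s / (u1 s)^3 - 2 * u s / u1 s = 0) /\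
  exists k, forall s, Rabs (s - s0) < r -> 1 + u s * u s = k * u1 s.
Proof.
  intros Hr HU Hu Hu1 Nu Hv Nv H.
  set (A s := (1 + u s * u s) * u2 s / (u1 s)^3 - 2 * u s / u1 s).
  change (forall s t, Rabs (s - s0) < r -> Rabs (t - t0) < r ->
    (1 + u s * u s + v t * v t) * A s = l1 * s + l2 * t + l3 * (U s + V t)) in H.
  assert (K0 := fun c => Rabs_minus_diag_lt c r Hr).
  destruct (exists_square_neq v v1 t0 r Hr Hv Nv) as [t1 [Ht1 Nt1]].
  set (alpha := (l2 * (t1 - t0) + l3 * (V t1 - V t0)) / (v t1 * v t1 - v t0 * v t0)).
  assert (HA : forall s, Rabs (s - s0) < r -> A s = alpha).
  { intros s Hs; unfold alpha; apply Rmult_eq_reg_r with (2 := Nt1).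
    unfold Rdiv; rewrite Rmult_assoc, Rinv_l, Rmult_1_r by exact Nt1.
    assert (H1 := H s t1 Hs Ht1); assert (H0 := H s t0 Hs (K0 t0)); lra. }
  assert (HB : forall s, Rabs (s - s0) < r ->
    2 * u s * u1 s * alpha = l1 + l3 * u s).
  { apply (is_derive_affine_relation U u u1 s0 r (v t0 * v t0) alpha l1 (l2 * t0) l3 (V t0));
      try assumption.
    intros s Hs; rewrite <- (HA s Hs); apply H; auto. }
  set (k := (1 + u s0 * u s0) / u1 s0 + alpha * u s0).
  assert (Hk : forall s, Rabs (s - s0) < r -> (1 + u s * u s) / u1 s + alpha * u s = k).
  { apply (is_derive_0_const (fun s => (1 + u s * u s) / u1 s + alpha * u s)).
    intros s Hs; assert (N := Nu s Hs).
    auto_derive.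
    - repeat split; try exact N;
        lazymatch goal with
        | |- ex_derive (fun y => u1 y) _ => exists (u2 s); exact (Hu1 s Hs)
        | _ => exists (u1 s); exact (Hu s Hs)
        end.
    - replace (Derive (fun y => u y) s) with (u1 s)
        by (symmetry; apply is_derive_unique, Hu, Hs).
      replace (Derive (fun y => u1 y) s) with (u2 s)
        by (symmetry; apply is_derive_unique, Hu1, Hs).
      rewrite <- (HA s Hs); unfold A; field; exact N. }
  assert (Hk' : forall s, Rabs (s - s0) < r -> 1 + u s * u s = (k - alpha * u s) * u1 s).
  { intros s Hs; rewrite <- (Hk s Hs); field; apply Nu, Hs. }
  assert (alpha0 : alpha = 0).
  { enough (2 * alpha = 0) by lra.
    apply (cubic_on_interval u u1 s0 r _ (alpha * l3) (2 * alpha + alpha * l1 - k * l3)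
       (- k * l1) Hr Hu Nu).
    intros s Hs.
    assert (E1 : 2 * u s * alpha * (1 + u s * u s) = (k - alpha * u s) * (l1 + l3 * u s)).
    { rewrite (Hk' s Hs), <- (HB s Hs); ring. }
    nra. }
  split.
  - intros s Hs; rewrite <- alpha0; apply HA, Hs.
  - exists k; intros s Hs; rewrite (Hk' s Hs), alpha0; ring.
Qed.

(** * Matrix products, connected domains and elementary derivatives *)

Lemma coord_Mmult (L : @matrix R 3 3) (v : vec3) (k : nat) : (k < 3)%nat ->
  coord (Mmult L v) k
  = ent L k 0 * coord v 0 + ent L k 1 * coord v 1 + ent L k 2 * coord v 2.
Proof.
  intros Hk; unfold Mmult; rewrite coord_mk_matrix by exact Hk.
  cbn [Nat.pred]; rewrite !sum_Sn, sum_O; reflexivity.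
Qed.

Lemma Mmult_zero_l (v : vec3) :
  Mmult (mk_matrix 3 3 (fun _ _ => 0)) v = mkvec3 0 0 0.
Proof.
  unfold Mmult, mk_matrix at 1; cbn [mk_Tn]; apply (f_equal3 mkvec3);
    cbn [Nat.pred]; rewrite !sum_Sn, sum_O; unfold plus, mult; cbn; ring.
Qed.

(** Balls of the product uniform structure are squares. *)
Lemma open_rectangle (D : R * R -> Prop) (s t : R) : open D -> D (s, t) ->
  exists r, 0 < r /\
    forall s' t', Rabs (s' - s) < r -> Rabs (t' - t) < r -> D (s', t').
Proof.
  intros HD Hst; destruct (HD _ Hst) as [r Hr].
  exists r; split; [apply cond_pos|].
  intros s' t' Hs Ht; apply Hr; split; assumption.
Qed.

(** Inside a small square one moves first in [t] and then in [s], so [G] is locally constant. The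
    points near which [G] equals [G s0 t0] and those near which it differs form two disjoint open
    sets covering [D], and connectedness leaves only the first. *)
Lemma zero_partials_const (D : R * R -> Prop) (G : R -> R -> R) :
  open D -> connected D ->
  (forall s t, D (s, t) -> is_derive (fun s' => G s' t) s 0) ->
  (forall s t, D (s, t) -> is_derive (fun t' => G s t') t 0) ->
  forall s0 t0 s t, D (s0, t0) -> D (s, t) -> G s t = G s0 t0.
Proof.
  intros Do Dc Hs Ht s0 t0 s1 t1 D0 D1.
  pose (g p := G (fst p) (snd p)).
  assert (L : forall p, D p -> locally p (fun q => D q /\ g q = g p)).
  { intros [s t] Dp; destruct (open_rectangle D s t Do Dp) as [r [Hr HR]].
    assert (K := fun c => Rabs_minus_diag_lt c r Hr).
    exists (mkposreal r Hr); intros [s' t'] [Bs Bt].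
    change (Rabs (s' - s) < r) in Bs; change (Rabs (t' - t) < r) in Bt.
    split; [apply HR; assumption|]; unfold g; cbn.
    rewrite (is_derive_0_const (fun t => G s' t) t r) by auto.
    apply (is_derive_0_const (fun s => G s t) s r); auto. }
  destruct (Req_dec (G s1 t1) (G s0 t0)) as [E|N]; [exact E|exfalso].
  destruct (Dc (fun p => locally p (fun q => D q /\ g q = G s0 t0))
               (fun p => locally p (fun q => D q /\ g q <> G s0 t0)))
    as [p [_ [P1 P2]]].
  - intros p Hp; apply (locally_locally p _ Hp).
  - intros p Hp; apply (locally_locally p _ Hp).
  - intros p Dp; destruct (Req_dec (g p) (G s0 t0)) as [E|E]; [left|right];
      (eapply filter_imp; [|exact (L p Dp)]); cbn; intros q [Dq Eq];
      rewrite Eq; auto.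
  - exists (s0, t0); split; [exact D0 | exact (L _ D0)].
  - exists (s1, t1); split; [exact D1|].
    eapply filter_imp; [|exact (L _ D1)]; cbn; intros q [Dq ->]; auto.
  - apply locally_singleton in P1; apply locally_singleton in P2; tauto.
Qed.

Lemma is_derive_atan_comp (u : R -> R) (z du : R) : is_derive u z du ->
  is_derive (fun y => atan (u y)) z (du / (1 + u z * u z)).
Proof.
  intros H; evar_last.
  - apply (is_derive_comp atan u); [apply is_derive_atan | exact H].
  - unfold scal; cbn; unfold mult; cbn; unfold Rsqr; field; nra.
Qed.

Lemma is_derive_ln_Rabs_cos (a b z : R) : cos (a * z + b) <> 0 ->
  is_derive (fun y => ln (Rabs (cos (a * y + b)))) z (- a * tan (a * z + b)).
Proof.
  intros H; auto_derive.
  - split; [exact H|]; split; [apply Rabs_pos_lt, H | trivial].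
  (* The derivative of the absolute value contributes a sign, and sign over absolute value is
     [1 / cos] in both cases. *)
  - unfold tan; destruct (Rlt_dec (cos (a * z + b)) 0) as [L|L].
    + rewrite sign_eq_m1, Rabs_left by exact L; field; exact H.
    + rewrite sign_eq_1, Rabs_right by lra; field; exact H.
Qed.

Lemma class_C3_ex_derive (u : R -> R) (I : R -> Prop) (z : R) :
  class_C 3 u I -> I z ->
  ex_derive u z /\ ex_derive (Derive u) z /\ ex_derive (Derive (Derive u)) z.
Proof.
  intros H Iz; destruct (H z Iz) as [K _]; repeat split.
  (* The index is shifted by one: [ex_derive_n u (S j)] is differentiability of the [j]-th
     derivative. *)
  - exact (K 1%nat ltac:(lia)).
  - exact (K 2%nat ltac:(lia)).
  - exact (K 3%nat ltac:(lia)).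
Qed.

(** * Vanishing of the mean curvature *)

(** The rows of [l] are those of [Lambda]. The first two give [A = B = 0] and constant inverse
    slopes [k], [k']; the third then says that [- W (k + k')] is linear in the position, which leads
    to a cubic equation for [u]. *)
Lemma inverse_slopes_cancel (U u u1 u2 V v v1 v2 : R -> R) (s0 t0 r : R)
    (l : nat -> nat -> R) :
  let A s := (1 + u s * u s) * u2 s / (u1 s)^3 - 2 * u s / u1 s in
  let B t := (1 + v t * v t) * v2 t / (v1 t)^3 - 2 * v t / v1 t in
  let W s t := 1 + u s * u s + v t * v t in
  let lin k s t := l k 0%nat * s + l k 1%nat * t + l k 2%nat * (U s + V t) in
  0 < r ->
  (forall s, Rabs (s - s0) < r -> is_derive U s (u s)) ->
  (forall s, Rabs (s - s0) < r -> is_derive u s (u1 s)) ->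
  (forall s, Rabs (s - s0) < r -> is_derive u1 s (u2 s)) ->
  (forall s, Rabs (s - s0) < r -> u1 s <> 0) ->
  (forall t, Rabs (t - t0) < r -> is_derive V t (v t)) ->
  (forall t, Rabs (t - t0) < r -> is_derive v t (v1 t)) ->
  (forall t, Rabs (t - t0) < r -> is_derive v1 t (v2 t)) ->
  (forall t, Rabs (t - t0) < r -> v1 t <> 0) ->
  (forall s t, Rabs (s - s0) < r -> Rabs (t - t0) < r ->
     W s t * A s = lin 0%nat s t /\
     W s t * B t = lin 1%nat s t /\
     W s t * (A s * u s + B t * v t
              - (1 + u s * u s) / u1 s - (1 + v t * v t) / v1 t) = lin 2%nat s t) ->
  (1 + u s0 * u s0) / u1 s0 + (1 + v t0 * v t0) / v1 t0 = 0.
Proof.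
  intros A B W lin Hr HU Hu Hu1 Nu HV Hv Hv1 Nv H.
  assert (Ks := Rabs_minus_diag_lt s0 r Hr).
  assert (Kt := Rabs_minus_diag_lt t0 r Hr).
  destruct (slope_coefficient_eq0 U u u1 u2 V v v1 s0 t0 r
    (l 0 0)%nat (l 0 1)%nat (l 0 2)%nat) as [HA [k Hk]]; try assumption.
  { intros s t Hs Ht; apply (H s t Hs Ht). }
  (* The roles of [s] and [t] are exchanged, hence so are columns 0 and 1 of [l]. *)
  destruct (slope_coefficient_eq0 V v v1 v2 U u u1 t0 s0 r
    (l 1 1)%nat (l 1 0)%nat (l 1 2)%nat) as [HB [k' Hk']]; try assumption.
  { intros t s Ht Hs; destruct (H s t Hs Ht) as (_ & E & _).
    unfold W, lin, B in E; lra. }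
  assert (Ek : forall s, Rabs (s - s0) < r -> (1 + u s * u s) / u1 s = k)
    by (intros s Hs; rewrite (Hk s Hs); field; auto).
  assert (Ek' : (1 + v t0 * v t0) / v1 t0 = k')
    by (rewrite (Hk' t0 Kt); field; auto).
  rewrite (Ek s0 Ks), Ek'.
  assert (H3 : forall s, Rabs (s - s0) < r ->
    W s t0 * (- k - k') = lin 2%nat s t0).
  { intros s Hs; destruct (H s t0 Hs Kt) as (_ & _ & <-).
    rewrite Ek, Ek' by exact Hs; unfold A, B; rewrite HA, HB by assumption; ring. }
  assert (HD : forall s, Rabs (s - s0) < r ->
    2 * u s * u1 s * (- k - k') = l 2%nat 0%nat + l 2%nat 2%nat * u s).
  { apply (is_derive_affine_relation U u u1 s0 r (v t0 * v t0) (- k - k')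
      (l 2%nat 0%nat) (l 2%nat 1%nat * t0) (l 2%nat 2%nat) (V t0)); assumption. }
  enough (2 * (- k - k') = 0) by lra.
  (* The cubic is [HD] multiplied by [k], with [k * u1 s] replaced by [1 + u s * u s]; its leading
     coefficient is [2 * (- k - k')]. *)
  apply (cubic_on_interval u u1 s0 r _ 0 (2 * (- k - k') - k * l 2%nat 2%nat)
    (- k * l 2%nat 0%nat) Hr Hu Nu).
  intros s Hs.
  assert (E : 2 * u s * (1 + u s * u s) * (- k - k')
    = k * (l 2%nat 0%nat + l 2%nat 2%nat * u s))
    by (rewrite (Hk s Hs), <- (HD s Hs); ring).
  lra.
Qed.

(** * Integration to Scherk's surface *)

(** A function of [s] equal to a function of [t] is constant, which gives [f' / (1 + f^2) = a1];
    integrating yields [atan f = a1 s + a2], and integrating the tangent yields the logarithm.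
    Functions of one variable are treated as functions on [D], because it is [D] that is
    connected. *)
Lemma scherk_of_slopes (D : R * R -> Prop) (ft ht : R -> R) :
  let f := Derive ft in let h := Derive ht in
  (exists p, D p) -> open D -> connected D ->
  (forall s t, D (s, t) -> is_derive ft s (f s) /\ is_derive ht t (h t)) ->
  (forall s t, D (s, t) -> ex_derive f s /\ ex_derive h t) ->
  (forall s t, D (s, t) -> ex_derive (Derive f) s /\ ex_derive (Derive h) t) ->
  (forall s t, D (s, t) -> Derive f s <> 0 /\ Derive h t <> 0) ->
  (forall s t, D (s, t) ->
     (1 + f s * f s) / Derive f s + (1 + h t * h t) / Derive h t = 0) ->
  exists a1 a2 b2 c : R, a1 <> 0 /\
    forall s t, D (s, t) ->
      cos (a1 * s + a2) <> 0 /\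
      cos (- a1 * t + b2) <> 0 /\
      ft s + ht t = c - 1 / a1 * ln (Rabs (cos (a1 * s + a2)))
                      + 1 / a1 * ln (Rabs (cos (- a1 * t + b2))).
Proof.
  intros f h [[s0 t0] D0] Do Dc H1 H2 H3 N E.
  assert (pq : forall s t, D (s, t) ->
    Derive f s / (1 + f s * f s) = - (Derive h t / (1 + h t * h t))).
  { intros s t Dst; destruct (N s t Dst); assert (Est := E s t Dst).
    assert (0 < 1 + f s * f s) by nra. assert (0 < 1 + h t * h t) by nra.
    assert (Q : (1 + f s * f s) / Derive f s = - ((1 + h t * h t) / Derive h t)) by lra.
    rewrite <- (Rinv_div (1 + f s * f s)), Q, <- (Rinv_div (1 + h t * h t)), Rinv_opp.
    reflexivity. }
  set (a1 := Derive f s0 / (1 + f s0 * f s0)).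
  assert (a1_neq0 : a1 <> 0).
  { destruct (N s0 t0 D0); apply Rmult_integral_contrapositive_currified;
      [assumption | apply Rinv_neq_0_compat; nra]. }
  assert (Hp : forall s t, D (s, t) -> Derive f s / (1 + f s * f s) = a1).
  { intros s t Dst.
    apply (zero_partials_const D (fun s _ => Derive f s / (1 + f s * f s)) Do Dc)
      with (t := t) (t0 := t0); trivial; clear s t Dst; intros s t Dst.
    (* By [pq] the quotient agrees, for fixed [t] and nearby [s], with an expression in [t] alone,
       so its [s]-derivative is 0. *)
    - destruct (open_rectangle D s t Do Dst) as [r [Hr HR]].
      apply (is_derive_ext_loc (fun _ => - (Derive h t / (1 + h t * h t)))).
      + exists (mkposreal r Hr); intros s' Hs'; symmetry; apply pq, HR;
          [exact Hs' | exact (Rabs_minus_diag_lt _ r Hr)].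
      + apply @is_derive_const.
    - apply @is_derive_const. }
  assert (Hq : forall s t, D (s, t) -> Derive h t / (1 + h t * h t) = - a1).
  { intros s t Dst; rewrite <- (Hp s t Dst), (pq s t Dst); ring. }
  set (a2 := atan (f s0) - a1 * s0).
  assert (Ha : forall s t, D (s, t) -> atan (f s) = a1 * s + a2).
  { intros s t Dst; enough (atan (f s) - a1 * s = a2) by lra.
    apply (zero_partials_const D (fun s _ => atan (f s) - a1 * s) Do Dc)
      with (t := t) (t0 := t0); trivial; clear s t Dst; intros s t Dst.
    - evar_last.
      + apply (is_derive_minus (fun s => atan (f s)) (fun s => a1 * s)).
        * apply is_derive_atan_comp, Derive_correct, (H2 s t Dst).
        * apply (is_derive_scal (fun s => s)), is_derive_id.
      + rewrite (Hp s t Dst); unfold minus, plus, opp, one; cbn; ring.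
    - apply @is_derive_const. }
  set (b2 := atan (h t0) + a1 * t0).
  assert (Hb : forall s t, D (s, t) -> atan (h t) = - a1 * t + b2).
  { intros s t Dst; enough (atan (h t) - - a1 * t = b2) by lra.
    replace b2 with (atan (h t0) - - a1 * t0) by (unfold b2; ring).
    apply (zero_partials_const D (fun _ t => atan (h t) - - a1 * t) Do Dc)
      with (s := s) (s0 := s0); trivial; clear s t Dst; intros s t Dst.
    - apply @is_derive_const.
    - evar_last.
      + apply (is_derive_minus (fun t => atan (h t)) (fun t => - a1 * t)).
        * apply is_derive_atan_comp, Derive_correct, (H2 s t Dst).
        * apply (is_derive_scal (fun t => t)), is_derive_id.
      + rewrite (Hq s t Dst); unfold minus, plus, opp, one; cbn; ring. }
  (* Here [a1 * s + a2] is a value of [atan], so it lies strictly between [- PI / 2] and [PI / 2],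
     where the cosine is positive. *)
  assert (Cs : forall s t, D (s, t) -> cos (a1 * s + a2) <> 0).
  { intros s t Dst; rewrite <- (Ha s t Dst).
    destruct (atan_bound (f s)); apply Rgt_not_eq, cos_gt_0; lra. }
  assert (Ct : forall s t, D (s, t) -> cos (- a1 * t + b2) <> 0).
  { intros s t Dst; rewrite <- (Hb s t Dst).
    destruct (atan_bound (h t)); apply Rgt_not_eq, cos_gt_0; lra. }
  (* The separated halves of the equation: their derivatives are [f - tan (atan f)] and
     [h - tan (atan h)], both 0. *)
  pose (X s := ft s + 1 / a1 * ln (Rabs (cos (a1 * s + a2)))).
  pose (Y t := ht t - 1 / a1 * ln (Rabs (cos (- a1 * t + b2)))).
  exists a1, a2, b2, (X s0 + Y t0); split; [exact a1_neq0|].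
  intros s t Dst; split; [|split]; [exact (Cs s t Dst) | exact (Ct s t Dst) |].
  enough (X s + Y t = X s0 + Y t0) by (unfold X, Y in *; lra).
  apply (zero_partials_const D (fun s t => X s + Y t) Do Dc); trivial;
    clear s t Dst; intros s t Dst; unfold X, Y.
  - evar_last.
    + apply @is_derive_plus; [apply @is_derive_plus | apply @is_derive_const].
      * apply (H1 s t Dst).
      * apply @is_derive_scal, is_derive_ln_Rabs_cos, (Cs s t Dst).
    + rewrite <- (Ha s t Dst), tan_atan.
      unfold plus, zero; cbn; field; exact a1_neq0.
  - evar_last.
    + apply @is_derive_plus; [apply @is_derive_const | apply @is_derive_minus].
      * apply (H1 s t Dst).
      * apply @is_derive_scal, is_derive_ln_Rabs_cos, (Ct s t Dst).
    + rewrite <- (Hb s t Dst), tan_atan.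
      unfold minus, plus, opp, zero; cbn; field; exact a1_neq0.
Qed.

(** * Slopes of Scherk's surface *)

Lemma scherk_slope (u : R -> R) (a b c k z : R) (P : R -> Prop) :
  a <> 0 -> locally z P ->
  (forall y, P y -> cos (a * y + b) <> 0 /\
     u y = c - 1 / a * ln (Rabs (cos (a * y + b))) + k) ->
  locally z (fun y => is_derive u y (tan (a * y + b))).
Proof.
  intros Ha HP H; apply locally_locally in HP.
  eapply filter_imp; [|exact HP]; cbn; intros y Hy.
  destruct (H y (locally_singleton _ _ Hy)) as [Cy _].
  apply (is_derive_ext_loc (fun y => c - 1 / a * ln (Rabs (cos (a * y + b))) + k)).
  - eapply filter_imp; [|exact Hy]; cbn; intros y' Py'.
    symmetry; apply (H y' Py').
  - evar_last.
    + apply @is_derive_plus; [apply @is_derive_minus | apply @is_derive_const].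
      * apply @is_derive_const.
      * apply @is_derive_scal, is_derive_ln_Rabs_cos, Cy.
    + unfold minus, plus, opp, zero; cbn; field; exact Ha.
Qed.

Lemma is_derive_tan_affine (a b z : R) : cos (a * z + b) <> 0 ->
  is_derive (fun y => tan (a * y + b)) z (a * (1 + tan (a * z + b) * tan (a * z + b))).
Proof.
  intros H; evar_last.
  - apply (is_derive_comp tan (fun y => a * y + b)); [apply is_derive_tan, H|].
    apply (is_derive_plus (fun y => a * y) (fun _ => b));
      [apply (is_derive_scal (fun y => y)), is_derive_id | apply @is_derive_const].
  - unfold scal, plus, zero, one; cbn; unfold mult; cbn; ring.
Qed.

(** With [u' = tan (a y + b)] one has [u'' = a (1 + u'^2)], so the inverse slope [(1 + u'^2) / u'']
    is the constant [1 / a], and the coefficient, a multiple of its derivative, vanishes. *)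
Lemma scherk_slope_coefficient (u : R -> R) (a b c k z : R) (P : R -> Prop) :
  a <> 0 -> locally z P ->
  (forall y, P y -> cos (a * y + b) <> 0 /\
     u y = c - 1 / a * ln (Rabs (cos (a * y + b))) + k) ->
  Derive (Derive u) z = a * (1 + Derive u z * Derive u z) /\
  (1 + Derive u z * Derive u z) * Derive (Derive (Derive u)) z / (Derive (Derive u) z)^3
    - 2 * Derive u z / Derive (Derive u) z = 0.
Proof.
  intros Ha HP H.
  assert (L1 : locally z (fun y => Derive u y = tan (a * y + b))).
  { eapply filter_imp; [|exact (scherk_slope u a b c k z P Ha HP H)].
    cbn; intros y; apply is_derive_unique. }
  assert (L2 : locally z (fun y =>
    is_derive (Derive u) y (a * (1 + Derive u y * Derive u y)))).
  { apply locally_locally in L1.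
    generalize (filter_and _ _ HP L1); apply filter_imp; intros y [Py Ly].
    apply (is_derive_ext_loc (fun y => tan (a * y + b))).
    - eapply filter_imp; [|exact Ly]; cbn; intros; symmetry; assumption.
    - rewrite (locally_singleton _ _ Ly); apply is_derive_tan_affine, (H y Py). }
  assert (D2 : is_derive (Derive u) z (a * (1 + Derive u z * Derive u z)))
    by exact (locally_singleton _ _ L2).
  assert (D3 : is_derive (Derive (Derive u)) z
    (a * (2 * Derive u z * (a * (1 + Derive u z * Derive u z))))).
  (* The summand 0 gives the expression the form required by [is_derive_square_plus]. *)
  { apply (is_derive_ext_loc (fun y => a * (1 + Derive u y * Derive u y + 0))).
    - eapply filter_imp; [|exact L2]; cbn; intros y Ly.
      rewrite (is_derive_unique _ _ _ Ly); ring.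
    - apply @is_derive_scal, is_derive_square_plus, D2. }
  rewrite (is_derive_unique _ _ _ D3), (is_derive_unique _ _ _ D2).
  split; [reflexivity|]; field; split; [nra | exact Ha].
Qed.

(** * Both directions on the domain [D] *)

Theorem theorem6 (D : R * R -> Prop) (ft ht : R -> R)
  (D_nonempty : exists p, D p)
  (D_open : open D)
  (D_connected : connected D)
  (ft_C3 : class_C 3 ft (fun s => exists t, D (s, t)))
  (ht_C3 : class_C 3 ht (fun t => exists s, D (s, t)))
  (K_neq0 : forall s t, D (s, t) ->
     gauss_curvature (translation_surface ft ht) s t <> 0) :
  (exists Lambda : @matrix R 3 3, forall s t, D (s, t) ->
     mk_matrix 3 1 (fun k _ =>
       Delta_III (translation_surface ft ht)
         (fun s' t' => coord (translation_surface ft ht s' t') k) s t)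
     = Mmult Lambda (translation_surface ft ht s t))
  <->
  (exists a1 a2 b2 c : R, a1 <> 0 /\
     forall s t, D (s, t) ->
       cos (a1 * s + a2) <> 0 /\
       cos (- a1 * t + b2) <> 0 /\
       ft s + ht t = c - 1 / a1 * ln (Rabs (cos (a1 * s + a2)))
                       + 1 / a1 * ln (Rabs (cos (- a1 * t + b2)))).
Proof.
  assert (Rf : forall s t, D (s, t) -> ex_derive ft s /\
    ex_derive (Derive ft) s /\ ex_derive (Derive (Derive ft)) s)
    by (intros s t Dst; apply (class_C3_ex_derive _ _ _ ft_C3); exists t; exact Dst).
  assert (Rh : forall s t, D (s, t) -> ex_derive ht t /\
    ex_derive (Derive ht) t /\ ex_derive (Derive (Derive ht)) t)
    by (intros s t Dst; apply (class_C3_ex_derive _ _ _ ht_C3); exists s; exact Dst).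
  assert (N : forall s t, D (s, t) ->
    Derive (Derive ft) s <> 0 /\ Derive (Derive ht) t <> 0)
    by (intros s t Dst; apply gauss_curvature_neq0, K_neq0, Dst).
  assert (Ls : forall s t, D (s, t) -> locally s (fun s' => D (s', t))).
  { intros s t Dst; destruct (open_rectangle D s t D_open Dst) as [r [Hr HR]].
    exists (mkposreal r Hr); intros s' Hs'; apply HR; [exact Hs'|].
    exact (Rabs_minus_diag_lt _ r Hr). }
  assert (Lt : forall s t, D (s, t) -> locally t (fun t' => D (s, t'))).
  { intros s t Dst; destruct (open_rectangle D s t D_open Dst) as [r [Hr HR]].
    exists (mkposreal r Hr); intros t' Ht'; apply HR; [|exact Ht'].
    exact (Rabs_minus_diag_lt _ r Hr). }
  (* The conclusion is inferred from [Delta_III_position]; its local hypotheses follow from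
     regularity at the nearby points of the slices of [D]. *)
  assert (Pos : forall s t, D (s, t) -> _) by
    (intros s t Dst; apply (Delta_III_position ft ht s t);
     [ eapply filter_imp; [|exact (Ls s t Dst)]; intros s' Ds'; apply (Rf s' t Ds')
     | eapply filter_imp; [|exact (Lt s t Dst)]; intros t' Dt'; apply (Rh s t' Dt')
     | apply (Rf s t Dst) | apply (Rh s t Dst)
     | apply (N s t Dst) | apply (N s t Dst) ]).
  cbv zeta in Pos.
  split.
  - intros [L HL].
    apply scherk_of_slopes; trivial.
    + intros s t Dst; split; apply Derive_correct; [apply (Rf s t Dst) | apply (Rh s t Dst)].
    + intros s t Dst; split; [apply (Rf s t Dst) | apply (Rh s t Dst)].
    + intros s t Dst; split; [apply (Rf s t Dst) | apply (Rh s t Dst)].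
    + intros s t Dst.
      (* [D] need not be a product, so [s] and [t] are varied independently only inside a square
         around the point. *)
      destruct (open_rectangle D s t D_open Dst) as [r [Hr HR]].
      assert (Hs : forall s', Rabs (s' - s) < r -> D (s', t))
        by (intros s' Hs'; apply HR; [exact Hs' | exact (Rabs_minus_diag_lt _ r Hr)]).
      assert (Ht : forall t', Rabs (t' - t) < r -> D (s, t'))
        by (intros t' Ht'; apply HR; [exact (Rabs_minus_diag_lt _ r Hr) | exact Ht']).
      apply (inverse_slopes_cancel ft (Derive ft) (Derive (Derive ft))
        (Derive (Derive (Derive ft))) ht (Derive ht) (Derive (Derive ht))
        (Derive (Derive (Derive ht))) s t r (fun i j => ent L i j)); trivial;
        try (intros s' Hs'; apply Derive_correct, (Rf s' t), Hs, Hs');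
        try (intros t' Ht'; apply Derive_correct, (Rh s t'), Ht, Ht').
      * intros s' Hs'; apply (N s' t), Hs, Hs'.
      * intros t' Ht'; apply (N s t'), Ht, Ht'.
      * intros s' t' Hs' Ht'; assert (D' := HR s' t' Hs' Ht').
        assert (E := HL s' t' D'); rewrite (Pos s' t' D') in E.
        repeat split.
        -- etransitivity; [exact (f_equal (fun v => coord v 0) E)|].
           apply coord_Mmult; lia.
        -- etransitivity; [exact (f_equal (fun v => coord v 1) E)|].
           apply coord_Mmult; lia.
        -- etransitivity; [exact (f_equal (fun v => coord v 2) E)|].
           apply coord_Mmult; lia.
  - intros (a1 & a2 & b2 & c & a1_neq0 & H).
    exists (mk_matrix 3 3 (fun _ _ => 0)); intros s t Dst.
    rewrite (Pos s t Dst), Mmult_zero_l.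
    destruct (scherk_slope_coefficient ft a1 a2 c
      (1 / a1 * ln (Rabs (cos (- a1 * t + b2))) - ht t) s _ a1_neq0 (Ls s t Dst))
      as [Ef ->].
    { intros s' Ds'; destruct (H s' t Ds') as (Cs & _ & E); split; [exact Cs | lra]. }
    assert (a1_neq0' : - a1 <> 0) by lra.
    (* Taking [- a1] for [a] turns the positive sign of the second logarithm into the negative one
       of the lemma. *)
    destruct (scherk_slope_coefficient ht (- a1) b2 c
      (- (1 / a1) * ln (Rabs (cos (a1 * s + a2))) - ft s) t _ a1_neq0' (Lt s t Dst))
      as [Eh ->].
    { intros t' Dt'; destruct (H s t' Dt') as (_ & Ct & E); split; [exact Ct|].
      replace (1 / - a1) with (- (1 / a1)) by (field; exact a1_neq0); lra. }
    (* The inverse slopes are now [1 / a1] and [1 / - a1], which cancel in the third coordinate. *)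
    rewrite Ef, Eh; apply (f_equal3 mkvec3); try ring.
    field; repeat split; nra.
Qed.
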